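(* Let $A,B\in\mathcal{L}(\mathcal{H})$ have closed ranges and satisfy $\mathcal{R}((B-A)^\dagger)=\mathcal{R}(B^\dagger-A^\dagger)$ and $\mathcal{R}((B^*-A^* )^\dagger)=\mathcal{R}((B^* )^\dagger-(A^* )^\dagger)$. Then $A\overset{-}{\leq}B$ if and only if $A\overset{\diamond}{\leq}B$.
   Context: $\mathcal{H}$ is a complex Hilbert space, $\mathcal{L}(\mathcal{H})$ is the algebra of bounded linear operators on $\mathcal{H}$, and $\mathcal{R}(T)$, $\mathcal{N}(T)$ denote range and nullspace. The Moore-Penrose inverse of $T\in\mathcal{L}(\mathcal{H})$ is the (in general densely defined, unbounded) operator $T^\dagger:\mathcal{R}(T)\oplus\mathcal{R}(T)^\perp\to\mathcal{H}$ with $T^\dagger|_{\mathcal{R}(T)}=(T|_{\mathcal{N}(T)^\perp})^{-1}$ (where $T|_{\mathcal{N}(T)^\perp}:\mathcal{N}(T)^\perp\to\mathcal{R}(T)$) and $\mathcal{N}(T^\dagger)=\mathcal{R}(T)^\perp$; $T^\dagger\in\mathcal{L}(\mathcal{H})$ if and only if $\mathcal{R}(T)$ is closed. Minus order: $A\overset{-}{\leq}B$ if there exist idempotents $P,Q\in\mathcal{L}(\mathcal{H})$ such that $A=PB$ and $A^*=QB^*$. Diamond order: $A\overset{\diamond}{\leq}B$ if $\mathcal{R}(A)\subseteq\mathcal{R}(B)$, $\mathcal{R}(A^* )\subseteq\mathcal{R}(B^* )$ and $AA^*A=AB^*A$. *)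

(* Defs.v *)
From HB Require Import structures.
From mathcomp Require Import all_boot all_order all_algebra.
From mathcomp Require Import sesquilinear complex.
From mathcomp Require Import all_classical all_reals all_analysis.

Set Implicit Arguments.
Unset Strict Implicit.
Unset Printing Implicit Defensive.

Import Order.TTheory GRing.Theory Num.Theory.
Import numFieldNormedType.Exports.

Local Open Scope classical_set_scope.
Local Open Scope ring_scope.
Local Open Scope complex_scope.

(* The inner product is linear in its first argument and conjugate-linear in
   the second one; the norm of the Banach space is the one it induces. *)
HB.mixin Record CompleteNormedModule_isHilbert (R : realType) H
    of CompleteNormedModule R[i] H := {
  inner : {dot H for (@Num.conj R[i])} ;
  inner_norm : forall x : H, inner x x = `|x| ^+ 2
}.

#[short(type="hilbertType")]
HB.structure Definition Hilbert (R : realType) :=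
  {H of CompleteNormedModule R[i] H & CompleteNormedModule_isHilbert R H}.

Notation "''[' x , y ]" := (inner x y) : ring_scope.

Section Operators.
Variables (R : realType) (H : hilbertType R).
Implicit Types (S : set H) (T A B : H -> H).

(* For linear maps this is boundedness of the operator: see linear_boundedP. *)
Definition bounded_operator (T : {linear H -> H}) : Prop :=
  bounded_near T (nbhs (0 : H)).

Definition nullspace T : set H := T @^-1` [set 0].

Definition orthocompl S : set H := [set y | forall x, S x -> '[x, y] = 0].

(* T^* y is the vector z representing the bounded functional x |-> <T x, y>. *)
Definition adjoint T : H -> H :=
  fun y => get [set z | forall x, '[T x, y] = '[x, z]].

(* Possibly unbounded operators; the values of op_fun outside op_dom are
   irrelevant. *)
Record partial_op := PartialOp { op_dom : set H; op_fun : H -> H }.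

Definition op_range (F : partial_op) : set H := op_fun F @` op_dom F.

Definition op_sub (F G : partial_op) : partial_op :=
  PartialOp (op_dom F `&` op_dom G) (op_fun F \- op_fun G).

(* For x in orthocompl (nullspace T) and z in orthocompl (range T), the
   Moore-Penrose inverse maps T x + z to x. *)
Definition mp_inverse T : partial_op :=
  PartialOp
    [set y | exists u z, [/\ range T u, orthocompl (range T) z & y = u + z]]
    (fun y => get [set x | orthocompl (nullspace T) x /\
                           exists2 z, orthocompl (range T) z & y = T x + z]).

Definition idempotent_operator (P : {linear H -> H}) : Prop :=
  bounded_operator P /\ P \o P = P.

Definition minus_le A B : Prop :=
  exists P Q : {linear H -> H},
    [/\ idempotent_operator P, idempotent_operator Q,
        A = P \o B & adjoint A = Q \o adjoint B].

Definition diamond_le A B : Prop :=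
  [/\ range A `<=` range B,
      range (adjoint A) `<=` range (adjoint B) &
      A \o adjoint A \o A = A \o adjoint B \o A].

Lemma inner_eq0 (x : H) : '[x, x] = 0 -> x = 0.
Proof.
by move=> /eqP; rewrite inner_norm expf_eq0/= normr_eq0 => /eqP.
Qed.

Lemma innerBr (x y z : H) : '[x, y - z] = '[x, y] - '[x, z].
Proof. exact: linearBr. Qed.

Lemma adjointE T y z : (forall x, '[T x, y] = '[x, z]) -> adjoint T y = z.
Proof.
move=> Tyz; rewrite /adjoint; case: xgetP => [w _ Tyw|/(_ z)//].
by apply/subr0_eq/inner_eq0; rewrite innerBr -Tyw -Tyz subrr.
Qed.

Lemma mp_inverseE (T : {linear H -> H}) x z :
  orthocompl (nullspace T) x -> orthocompl (range T) z ->
  op_fun (mp_inverse T) (T x + z) = x.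
Proof.
move=> Nx Rz /=; case: xgetP => [w _ [Nw [z' Rz' E]]|/(_ x)]; last first.
  by case; split=> //; exists z.
have Twx : T (w - x) = z - z'.
  by rewrite linearB/=; apply/eqP; rewrite subr_eq addrAC eq_sym subr_eq
             addrC E addrC.
have T0 : T (w - x) = 0.
  apply: inner_eq0; rewrite {2}Twx innerBr Rz ?Rz' ?subrr//;
  by exists (w - x).
apply/subr0_eq/inner_eq0.
by rewrite innerBr Nw ?Nx ?subrr.
Qed.

End Operators.

(* Main.v *)
Require Import Defs.
From HB Require Import structures.
From mathcomp Require Import all_boot all_order all_algebra.
From mathcomp Require Import sesquilinear complex ring lra.
From mathcomp Require Import all_classical all_reals all_analysis.
Import Order.TTheory GRing.Theory Num.Theory.
Import numFieldNormedType.Exports.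

(** Write [A'] for the adjoint of [A], and [GA], [GB] for the Moore-Penrose
    inverses of [A] and [B]; they are bounded because the ranges are closed.

    The diamond identity [A A' A = A B' A] is equivalent to [GA B GA = GA]
    ([diamond_identityP]): [GA] is an outer inverse of [B].  The minus order, on
    the other hand, amounts to [A GB A = A] together with the inclusions of the
    ranges of [A] and [A'] in those of [B] and [B']; the idempotents are
    [A GB] and the adjoint of [GB A].  Both orders imply the two inclusions, and
    what the range conditions do is to pass between the two identities.

    The first condition says that the range of [GB - GA] is the orthogonal
    complement of the null space of [B - A].  In the minus order every vector
    can be moved, modulo the null space of [A], into the null space of [B - A].
    For [y = GA x] the vector [z = y - GA B y] equals [(GB - GA) B y], so it is
    orthogonal to the null space of [B - A]; it also lies in the range of [GA],
    hence is orthogonal to the null space of [A].  So [z] is orthogonal to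
    everything and vanishes ([outer_inverse_of_lift]).  The converse is the same
    argument with the pairs [(A, B)] and [(GA, GB)] exchanged: the vector
    [A x - A GB A x] lies in the range of [B - A], which the second condition
    places inside the range of the adjoint of [GB - GA]
    ([inner_inverse_of_outer]).

    The analysis behind this is the projection theorem, the Riesz representation
    (for the existence of adjoints), and the boundedness of [GA].  The latter is
    deduced from the uniform boundedness principle
    ([weakly_bounded_bounded]): it bounds the adjoint from below on the range of
    the operator, and duality transfers the bound to the operator on the
    orthogonal complement of its null space ([closed_range_bounded_below]). *)

Set Implicit Arguments.
Unset Strict Implicit.
Unset Printing Implicit Defensive.

Local Open Scope classical_set_scope.
Local Open Scope ring_scope.
Local Open Scope complex_scope.

(** * Real norm and real inner product *)

Section RealInnerProduct.
Variables (R : realType) (H : hilbertType R).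
Implicit Types (x y z : H) (a : R).

(** Norms and inner products take values in [R[i]], which is only partially
    ordered; all estimates are made with these real-valued counterparts. *)
Definition rnorm x : R := complex.Re `|x|.
Definition rinner x y : R := complex.Re '[x, y].

Lemma normE x : `|x| = (rnorm x)%:C.
Proof. by rewrite /rnorm RRe_real// ger0_real. Qed.

Lemma rnorm_ge0 x : 0 <= rnorm x.
Proof. by rewrite -ler0c -normE. Qed.

Lemma rnormN x : rnorm (- x) = rnorm x.
Proof. by rewrite /rnorm normrN. Qed.

Lemma rnormB x y : rnorm (x - y) = rnorm (y - x).
Proof. by rewrite -rnormN opprB. Qed.

Lemma rnormD x y : rnorm (x + y) <= rnorm x + rnorm y.
Proof. by rewrite -lecR rmorphD/= -!normE ler_normD. Qed.

Lemma rnorm_tri y x z : rnorm (x - z) <= rnorm (x - y) + rnorm (y - z).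
Proof. by rewrite -[x in leLHS](subrK y) -addrA rnormD. Qed.

Lemma rinnerxx x : rinner x x = rnorm x ^+ 2.
Proof. by rewrite /rinner inner_norm normE -rmorphXn. Qed.

Lemma innerC x y : '[x, y] = '[y, x]^*.
Proof. by rewrite hermC/= expr0 mul1r. Qed.

Lemma inner_eq0C x y : '[x, y] = 0 -> '[y, x] = 0.
Proof. by move=> xy0; rewrite innerC xy0 conjc0. Qed.

Lemma rinnerC x y : rinner x y = rinner y x.
Proof. by rewrite /rinner innerC; case: '[y, x]. Qed.

Lemma rinnerDl x y z : rinner (x + y) z = rinner x z + rinner y z.
Proof. by rewrite /rinner linearDl raddfD. Qed.

Lemma rinnerNl x y : rinner (- x) y = - rinner x y.
Proof. by rewrite /rinner linearNl raddfN. Qed.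

Lemma rinnerBl x y z : rinner (x - y) z = rinner x z - rinner y z.
Proof. by rewrite rinnerDl rinnerNl. Qed.

Lemma rinnerZl a x y : rinner (a%:C *: x) y = a * rinner x y.
Proof.
rewrite /rinner linearZl_LR/=; case: '[x, y] => b c /=.
by rewrite mul0r subr0.
Qed.

Lemma rinnerDr x y z : rinner x (y + z) = rinner x y + rinner x z.
Proof. by rewrite rinnerC rinnerDl !(rinnerC x). Qed.

Lemma rinnerBr x y z : rinner x (y - z) = rinner x y - rinner x z.
Proof. by rewrite rinnerC rinnerBl !(rinnerC x). Qed.

Lemma rinnerZr a x y : rinner x (a%:C *: y) = a * rinner x y.
Proof. by rewrite rinnerC rinnerZl rinnerC. Qed.

Lemma rnorm_eq0 x : rnorm x = 0 -> x = 0.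
Proof. by move=> x0; apply/eqP; rewrite -normr_eq0 normE x0. Qed.

Lemma rnormZc (c : R[i]) x : rnorm (c *: x) = complex.Re `|c| * rnorm x.
Proof. by rewrite /rnorm normrZ normE normc_def/= mul0r subr0. Qed.

Lemma rnormZ a x : rnorm (a%:C *: x) = `|a| * rnorm x.
Proof. by rewrite rnormZc normc_def/= expr0n/= addr0 sqrtr_sqr. Qed.

Lemma rnorm0 : rnorm 0 = 0.
Proof. by rewrite /rnorm normr0. Qed.

(** The discriminant of a quadratic polynomial that is nowhere negative; it
    yields the Cauchy-Schwarz inequality for [e = rnorm x ^+ 2], and the
    orthogonality of almost minimisers for small [e]. *)
Lemma discriminant_le (e b c : R) : 0 <= e -> 0 <= c ->
  (forall a, 0 <= e - 2 * a * b + a ^+ 2 * c ^+ 2) -> `|b| <= Num.sqrt e * c.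
Proof.
move=> e0 c0 h.
rewrite -(@ler_pXn2r _ 2)// ?nnegrE ?mulr_ge0// ?sqrtr_ge0//.
rewrite exprMn sqr_sqrtr// real_normK ?num_real//.
have [cE|cN0] := eqVneq c 0.
  rewrite {}cE in c0 h *; have [->|bN0] := eqVneq b 0; first by rewrite expr0n/= mulr0.
  have := h ((e + 1) / b).
  have -> : e - 2 * ((e + 1) / b) * b + ((e + 1) / b) ^+ 2 * 0 ^+ 2 = - e - 2.
    by field.
  lra.
have c2 : c ^+ 2 > 0 by rewrite exprn_gt0// lt_neqAle eq_sym cN0.
have := h (b / c ^+ 2).
rewrite -(pmulr_lge0 _ c2).
have -> : (e - 2 * (b / c ^+ 2) * b + (b / c ^+ 2) ^+ 2 * c ^+ 2) * c ^+ 2 =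
  e * c ^+ 2 - b ^+ 2 by field.
by rewrite subr_ge0.
Qed.

Lemma rnorm_sqrB a x y :
  rnorm (x - a%:C *: y) ^+ 2
  = rnorm x ^+ 2 - 2 * a * rinner x y + a ^+ 2 * rnorm y ^+ 2.
Proof.
rewrite -!rinnerxx !(rinnerBl, rinnerBr, rinnerZl, rinnerZr) (rinnerC y x).
ring.
Qed.

Lemma CauchySchwarz_rinner x y : `|rinner x y| <= rnorm x * rnorm y.
Proof.
rewrite -[rnorm x in leRHS]ger0_norm ?rnorm_ge0// -(sqrtr_sqr (rnorm x)).
apply: discriminant_le; rewrite ?sqr_ge0 ?rnorm_ge0// => a.
by rewrite -rnorm_sqrB sqr_ge0.
Qed.

(** The parallelogram law for [x - y] and [x - z]: two points that almost
    minimise the distance to [x] in a convex set are close to each other, as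
    their midpoint cannot do much better. *)
Lemma parallelogram x y z :
  rnorm (y - z) ^+ 2 = 2 * rnorm (x - y) ^+ 2 + 2 * rnorm (x - z) ^+ 2
    - 4 * rnorm (x - (2^-1)%:C *: (y + z)) ^+ 2.
Proof.
rewrite -!rinnerxx !(rinnerBl, rinnerBr, rinnerZl, rinnerZr, rinnerDl, rinnerDr).
rewrite (rinnerC z y) (rinnerC y x) (rinnerC z x); by field.
Qed.

(** The imaginary part of an inner product is minus the real part after
    multiplication by ['i], so real orthogonality to a complex line is complex
    orthogonality. *)
Lemma rinner_eq0 x y : (forall c : R[i], rinner (c *: x) y = 0) -> '[x, y] = 0.
Proof.
move=> h; move: (h 1) (h 'i).
rewrite !scale1r /rinner !linearZl_LR/=.
case: '[x, y] => a b /= ->; rewrite mul0r mul1r sub0r => /eqP.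
by rewrite oppr_eq0 => /eqP ->.
Qed.

Lemma inner0l y : '[0, y] = 0 :> R[i].
Proof. exact: linear0l. Qed.

Lemma innerZr c x y : '[x, c *: y] = conjc c * '[x, y].
Proof. exact: linearZr_LR. Qed.

Lemma innerZl c x y : '[c *: x, y] = c * '[x, y].
Proof. exact: linearZl_LR. Qed.

Lemma innerDl x y z : '[x + y, z] = '[x, z] + '[y, z].
Proof. exact: linearDl. Qed.

Lemma innerBl x y z : '[x - y, z] = '[x, z] - '[y, z].
Proof. exact: linearBl. Qed.

Lemma innerDr x y z : '[x, y + z] = '[x, y] + '[x, z].
Proof. exact: linearDr. Qed.

(** Completeness for sequences with an explicit rate [r]: the limit inherits the
    rate, which is what both constructions by successive approximation use. *)
Lemma complete_rate (u : nat -> H) (r : nat -> R) :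
  (forall n m, (n <= m)%N -> rnorm (u n - u m) <= r n) ->
  (forall e, 0 < e -> exists n, r n < e) ->
  exists l, forall n, rnorm (u n - l) <= r n.
Proof.
move=> ur r0.
have ucvg : cvg (u @ \oo).
  apply: cauchy_cvg; apply: cauchy_exP => e e0.
  have e0' : 0 < complex.Re e by move: e0; rewrite ltcE => /andP[].
  have eE : e = (complex.Re e)%:C by rewrite RRe_real// gtr0_real.
  have [n rn] := r0 _ e0'.
  exists (u n); exists n => // m /= nm.
  rewrite -ball_normE/= normE eE ltcR.
  exact: le_lt_trans (ur _ _ nm) rn.
exists (lim (u @ \oo)) => n.
apply/ler_addgt0Pr => e e0.
have /cvgrPdist_lt/(_ e%:C) := ucvg.
rewrite ltcR => /(_ e0)[N _ /(_ (maxn n N))/=].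
rewrite leq_maxr normE ltcR => /(_ isT) lN.
apply: le_trans (rnorm_tri (u (maxn n N)) _ _) _.
by rewrite lerD ?ur ?leq_maxl// rnormB ltW.
Qed.

Lemma closureP (S : set H) x :
  closure S x <-> forall e, 0 < e -> exists2 s, S s & rnorm (x - s) < e.
Proof.
split=> [cx e e0|cx B].
  have [] := cx (ball x e%:C); first by apply: nbhsx_ballx; rewrite ltcR.
  move=> s [Ss]; rewrite -ball_normE/= normE ltcR; by exists s.
move=> /nbhs_ballP[e/= e0 eB].
have e0' : 0 < complex.Re e by move: e0; rewrite ltcE => /andP[].
have [s Ss xs] := cx _ e0'.
exists s; split=> //; apply: eB.
rewrite -ball_normE/= normE.
by rewrite -[e]RRe_real ?gtr0_real// ltcR.
Qed.

Lemma bounded_operatorP (T : {linear H -> H}) :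
  bounded_operator T <-> exists2 M : R, 0 <= M &
    forall x, rnorm (T x) <= M * rnorm x.
Proof.
split=> [|[M M0 TM]].
  move=> /linear_boundedP/pinfty_ex_gt0[M M0 TM].
  have ME : M = (complex.Re M)%:C by rewrite RRe_real// gtr0_real.
  exists (complex.Re M); first by rewrite -ler0c -ME ltW.
  by move=> x; have := TM x; rewrite ME !normE -rmorphM/= lecR.
apply/bounded_funP => r; exists (M%:C * r) => x xr.
by apply: le_trans (ler_wpM2l _ xr); rewrite ?ler0c// !normE -rmorphM lecR.
Qed.

End RealInnerProduct.

(** * Orthogonal projection and Riesz representation *)

Section Projection.
Variables (R : realType) (H : hilbertType R).
Implicit Types (x y z : H) (S : set H).

Lemma geometric_lt (b e : R) : 0 < b < 1 -> 0 < e -> exists n, b ^+ n < e.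
Proof.
move=> /andP[b0 b1] e0.
have b1' : `|b| < 1 by rewrite ger0_norm// ltW.
have /cvgrPdist_lt/(_ _ e0)[n _ /(_ n (leqnn n))/=] := cvg_expr b1'.
by rewrite sub0r normrN ger0_norm ?exprn_ge0 ?ltW//; exists n.
Qed.

Definition subspace S := S 0 /\ forall (a : R[i]) x y, S x -> S y -> S (a *: x + y).

Lemma subspaceZ S a x : subspace S -> S x -> S (a *: x).
Proof. by case=> S0 SD Sx; rewrite -[a *: x]addr0; exact: SD. Qed.

Lemma subspaceD S x y : subspace S -> S x -> S y -> S (x + y).
Proof. by case=> _ SD Sx Sy; rewrite -[x]scale1r; exact: SD. Qed.

Lemma range_subspace (T : {linear H -> H}) : subspace (range T).
Proof.
split; first by exists 0; rewrite ?linear0.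
by move=> a _ _ [x _ <-] [y _ <-]; exists (a *: x + y); rewrite ?linearP.
Qed.

Lemma nullspace_subspace (T : {linear H -> H}) : subspace (nullspace T).
Proof.
split=> [|a x y]; first exact: linear0.
by rewrite /nullspace/= linearP => -> ->; rewrite scaler0 addr0.
Qed.

Lemma rinner_orthocompl S y : subspace S -> (forall s, S s -> rinner s y = 0) ->
  orthocompl S y.
Proof.
by move=> SS h s Ss; apply: rinner_eq0 => c; apply: h; exact: subspaceZ.
Qed.

(** [S] is not assumed closed, so the minimising sequence converges to a point
    of the closure only.  This version also yields the density of the range of
    an adjoint in the orthogonal complement of the null space. *)
Lemma orthogonal_projection S x : subspace S ->
  exists2 p, closure S p & orthocompl S (x - p).
Proof.
move=> SS; pose D := [set rnorm (x - s) ^+ 2 | s in S]; pose d := inf D.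
have D0 : lbound D 0 by move=> _ [s _ <-]; rewrite sqr_ge0.
have infD : has_inf D.
  by split; [exists (rnorm (x - 0) ^+ 2), 0 => //; case: SS | exists 0].
have dle s : S s -> d <= rnorm (x - s) ^+ 2.
  by move=> Ss; apply: ge_inf; [exists 0 | exists s].
pose q n : R := 2^-1 ^+ n.
have q0 n : 0 < q n by rewrite exprn_gt0// invr_gt0.
have /choice[u uP] n : exists s, S s /\ rnorm (x - s) ^+ 2 < d + q n ^+ 2.
  have q2 : 0 < q n ^+ 2 by rewrite exprn_gt0.
  by have [_ [s Ss <-] us] := inf_adherent q2 infD; exists s.
have q_small e : 0 < e -> exists n, q n < e.
  by apply: geometric_lt; rewrite invr_gt0 ltr0n invf_lt1 ?ltr1n.
(* The parallelogram law turns the excess [q n ^+ 2] over the infimum into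
   a distance of at most [2 * q n]. *)
have uCauchy n m : (n <= m)%N -> rnorm (u n - u m) <= 2 * q n.
  move=> nm; have qmn : q m <= q n.
    by apply: ler_wiXn2l; rewrite // ?invr_ge0// invf_le1 ?ler1n.
  rewrite -(@ler_pXn2r _ 2)// ?nnegrE ?mulr_ge0 ?rnorm_ge0 1?ltW//.
  rewrite (parallelogram x).
  have := dle _ (subspaceZ (2^-1)%:C SS (subspaceD SS (uP n).1 (uP m).1)).
  have := (uP n).2; have := (uP m).2.
  have : q m ^+ 2 <= q n ^+ 2 by rewrite ler_pXn2r// ?nnegrE ltW.
  rewrite exprMn; lra.
have [p pP] : exists p, forall n, rnorm (u n - p) <= 2 * q n.
  apply: complete_rate => // e e0.
  have [|n qe] := q_small (e / 2); first by rewrite divr_gt0.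
  by exists n; rewrite mulrC -ltr_pdivlMr.
exists p.
  apply/closureP => e e0.
  have [|n qe] := q_small (e / 2); first by rewrite divr_gt0.
  exists (u n); first exact: (uP n).1.
  by rewrite rnormB (le_lt_trans (pP n))// mulrC -ltr_pdivlMr.
(* Each [u n] is an almost minimiser, hence [x - u n] is almost orthogonal to
   [t]; so is the limit [x - p]. *)
apply: rinner_orthocompl => // t St; rewrite rinnerC.
apply/eqP; rewrite -normr_le0; apply/ler_addgt0Pr => e e0; rewrite add0r.
have t1 : 0 < rnorm t + 1 by rewrite ltr_wpDl ?rnorm_ge0.
have [|n] := q_small (e / 3 / (rnorm t + 1)); first by rewrite !divr_gt0.
rewrite ltr_pdivlMr// => qe.
rewrite -(subrK (u n) x) -addrA rinnerDl (le_trans (ler_normD _ _))//.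
have : `|rinner (x - u n) t| <= q n * rnorm t.
  rewrite -(ger0_norm (ltW (q0 n))) -(sqrtr_sqr (q n)).
  apply: discriminant_le; rewrite ?sqr_ge0 ?rnorm_ge0// => a.
  have := dle _ (subspaceD SS (uP n).1 (subspaceZ a%:C SS St)).
  rewrite opprD addrA rnorm_sqrB.
  have := (uP n).2; lra.
have : `|rinner (u n - p) t| <= 2 * q n * rnorm t.
  apply: le_trans (CauchySchwarz_rinner _ _) _.
  by rewrite ler_wpM2r ?rnorm_ge0.
have := q0 n; nra.
Qed.

Lemma closed_projection S x : subspace S -> closed S ->
  exists2 p, S p & orthocompl S (x - p).
Proof.
move=> SS /closure_id clS.
by have [p Sp xp] := orthogonal_projection x SS; exists p; rewrite // clS.
Qed.

Lemma closure_orthocompl S x y : closure S x -> orthocompl S y -> '[x, y] = 0.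
Proof.
have real_part z : closure S x -> orthocompl S z -> rinner x z = 0.
  move=> /closureP Sx Sz.
  apply/eqP; rewrite -normr_le0; apply/ler_addgt0Pr => e e0; rewrite add0r.
  have z1 : 0 < rnorm z + 1 by rewrite ltr_wpDl ?rnorm_ge0.
  have [|s Ss] := Sx (e / (rnorm z + 1)); first by rewrite divr_gt0.
  rewrite ltr_pdivlMr// => xs.
  have -> : rinner x z = rinner (x - s) z.
    by rewrite rinnerBl [X in _ - X]/rinner Sz// subr0.
  apply: le_trans (CauchySchwarz_rinner _ _) _.
  by have := rnorm_ge0 (x - s); nra.
move=> Sx Sy; apply: rinner_eq0 => c.
rewrite /rinner innerZl -[c]conjcK -innerZr; apply: real_part => // s Ss.
by rewrite innerZr Sy ?mulr0.
Qed.

(** Only the real part of the functional is assumed bounded: a bound for its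
    modulus follows by homogeneity. *)
Theorem Riesz_representation (f : {scalar H}) (M : R) :
  (forall x, complex.Re (f x) <= M * rnorm x) ->
  exists z, forall x, f x = '[x, z].
Proof.
move=> fM.
have [f0|] := pselect (forall x, f x = 0).
  by exists 0 => x; rewrite f0 linear0r.
move=> /existsNP[v /eqP fv].
pose K := [set x | f x = 0].
have KK : subspace K.
  by split=> [|a x y]; rewrite /K/= ?linear0// linearP => -> ->; rewrite mulr0 addr0.
have clK : closed K.
  apply/closure_id/seteqP; split; first exact: subset_closure.
  move=> x Kx.
  (* As [f] vanishes on [K], [f (c *: x)] is the value of [f] at
     [c *: (x - s)] for [s] in [K] arbitrarily close to [x]; the choice
     [c := (f x)^* ] then makes [c * f x] the squared modulus. *)
  have Re_le c : complex.Re (c * f x) <= 0.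
    apply/ler_addgt0Pr => e e0; rewrite add0r.
    pose k := `|M| * complex.Re `|c| + 1.
    have c0 : 0 <= complex.Re `|c| by rewrite normc_def/= sqrtr_ge0.
    have k0 : 0 < k by rewrite ltr_wpDl// mulr_ge0.
    have [|s Ks] := (closureP _ _).1 Kx (e / k); first by rewrite divr_gt0.
    rewrite ltr_pdivlMr// => xs.
    have -> : c * f x = f (c *: (x - s)) by rewrite linearZ linearB/= Ks subr0.
    apply: le_trans (fM _) _; rewrite rnormZc; apply: le_trans _ (ltW xs).
    have := ler_wpM2r (mulr_ge0 c0 (rnorm_ge0 (x - s))) (ler_norm M).
    by have := rnorm_ge0 (x - s); rewrite /k; lra.
  have := Re_le (f x)^*; rewrite mulrC -normCK => Re_le0.
  apply/eqP; rewrite -normr_eq0 -sqrf_eq0 eq_le exprn_ge0// andbT.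
  by rewrite lecE Re_le0 (ger0_Im (exprn_ge0 2 (normr_ge0 (f x)))) eqxx.
have [p Kp vp] := closed_projection v KK clK.
pose e := v - p.
have fe : f e = f v by rewrite linearB/= Kp subr0.
have fe0 : f e != 0 by rewrite fe.
have ee : '[e, e] != 0.
  by apply: contra_neq fv => /inner_eq0 e0; rewrite -fe e0 linear0.
(* The kernel has codimension one: [e] spans its orthogonal complement. *)
exists (conjc (f e / '[e, e]) *: e) => x.
have : '[x - (f x / f e) *: e, e] = 0.
  by apply: vp; rewrite /K/= linearB linearZ/= divfK ?subrr ?fe.
move=> /eqP; rewrite innerBl innerZl subr_eq0 => /eqP xe.
rewrite innerZr conjcK xe; field.
by apply/andP; split.
Qed.

End Projection.

(** * Uniform boundedness and adjoints *)

Section Adjoint.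
Variables (R : realType) (H : hilbertType R).
Implicit Types (x y z : H) (S : set H).

(** The uniform boundedness principle, by a gliding hump.  If [S] is unbounded,
    choose [w n] in [S] with norm larger than [2 * n.+1 * 3 ^ n], and move by at
    most [3 ^ (- n)] in the direction of [w n], with the sign that makes the
    inner product with [w n] at least [3 ^ (- n) * rnorm (w n)].  The later
    moves sum up to at most half of [3 ^ (- n)] and cannot undo this, so the
    inner product of the limit with [w n] exceeds [n.+1] for every [n]. *)
Theorem weakly_bounded_bounded S :
  (forall y, exists M, forall w, S w -> rinner y w <= M) ->
  exists M, forall w, S w -> rnorm w <= M.
Proof.
move=> wb; apply: contrapT => /forallNP nb.
have /choice[w wP] (n : nat) :
    exists w, S w /\ 2 * n.+1%:R * 3 ^+ n < rnorm w.
  have /existsNP[w /not_implyP[Sw /negP]] := nb (2 * n.+1%:R * 3 ^+ n).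
  by rewrite -ltNge => nw; exists w.
pose q n : R := 3^-1 ^+ n.
have q0 n : 0 < q n by rewrite exprn_gt0// invr_gt0.
have qS n : q n.+1 = q n / 3 by rewrite /q exprSr.
have w0 n : 0 < rnorm (w n).
  by apply: le_lt_trans (wP n).2; rewrite !mulr_ge0// exprn_ge0.
have step n x : exists y, rnorm (x - y) <= q n /\
    q n * rnorm (w n) <= `|rinner y (w n)|.
  have dist (e : R) : e \in [:: 1; -1] ->
      rnorm (x - (x + (e * (q n / rnorm (w n)))%:C *: w n)) <= q n.
    move=> e1; rewrite opprD addrA subrr sub0r rnormN rnormZ !normrM.
    rewrite (gtr0_norm (q0 n)) normfV (gtr0_norm (w0 n)).
    rewrite -mulrA divfK ?gt_eqF//.
    by move: e1; rewrite !inE => /orP[] /eqP->; rewrite ?normrN normr1 mul1r.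
  have inn (e : R) :
      rinner (x + (e * (q n / rnorm (w n)))%:C *: w n) (w n)
      = rinner x (w n) + e * (q n * rnorm (w n)).
    rewrite rinnerDl rinnerZl rinnerxx; field.
    exact: lt0r_neq0 (w0 n).
  have qw : 0 < q n * rnorm (w n) by rewrite mulr_gt0.
  have [x0|x0] := leP 0 (rinner x (w n)).
    exists (x + (1 * (q n / rnorm (w n)))%:C *: w n).
    split; first by rewrite dist ?inE ?eqxx.
    by rewrite inn mul1r ger0_norm; lra.
  exists (x + (- 1 * (q n / rnorm (w n)))%:C *: w n).
  split; first by rewrite dist ?inE ?eqxx ?orbT.
  by rewrite inn ltr0_norm; lra.
have /choice[f fP] (nx : nat * H) : exists y, rnorm (nx.2 - y) <= q nx.1 /\
    q nx.1 * rnorm (w nx.1) <= `|rinner y (w nx.1)|.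
  exact: step.
pose u := nat_rect (fun=> H) 0 (fun n x => f (n, x)).
have udist n : rnorm (u n - u n.+1) <= q n := (fP (n, u n)).1.
have uinner n : q n * rnorm (w n) <= `|rinner (u n.+1) (w n)| := (fP (n, u n)).2.
have urate n m : (n <= m)%N -> rnorm (u n - u m) <= 3 / 2 * q n.
  move=> /subnKC <-.
  suff : rnorm (u n - u (n + (m - n))%N) <= 3 / 2 * (q n - q (n + (m - n))%N).
    by have := q0 (n + (m - n))%N; lra.
  elim: (m - n)%N => [|k IH]; first by rewrite addn0 !subrr mulr0 rnorm0.
  rewrite addnS qS (le_trans (rnorm_tri (u (n + k)%N) _ _))//.
  by have := udist (n + k)%N; lra.
have [l lP] : exists l, forall n, rnorm (u n - l) <= 3 / 2 * q n.
  apply: complete_rate => // e e0.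
  have [||n qe] := @geometric_lt _ 3^-1 (e / 2).
  - by rewrite invr_gt0 ltr0n invf_lt1 ?ltr1n.
  - by rewrite divr_gt0.
  - by exists n; rewrite -/(q n) in qe; lra.
have linner n : n.+1%:R < `|rinner l (w n)|.
  have := uinner n; rewrite -[X in rinner X](subrK l) rinnerDl => uwn.
  have {uwn} := le_trans uwn (ler_normD _ _).
  have := CauchySchwarz_rinner (u n.+1 - l) (w n).
  have : rnorm (u n.+1 - l) * rnorm (w n) <= q n / 2 * rnorm (w n).
    apply: ler_wpM2r; first exact: ltW.
    by apply: le_trans (lP _) _; rewrite qS; lra.
  have : 2 * n.+1%:R < q n * rnorm (w n).
    have := (wP n).2; rewrite -(ltr_pM2l (q0 n)).
    by rewrite mulrCA /q -exprMn mulVf// expr1n mulr1.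
  lra.
have [M1 lM1] := wb l; have [M2 lM2] := wb (- l).
have := linner (Num.truncn (`|M1| + `|M2|)).
set n := Num.truncn _ => nl.
have : `|M1| + `|M2| < n.+1%:R by exact: truncnS_gt.
have := lM1 _ (wP n).1; have := lM2 _ (wP n).1; rewrite rinnerNl.
have := ler_norm M1; have := ler_norm M2.
have := normr_ge0 M1; have := normr_ge0 M2.
by move: nl; case: (ger0P (rinner l (w n))); lra.
Qed.

Definition is_adjoint (T S : H -> H) := forall x y, '[T x, y] = '[x, S y].

Lemma is_adjointC (T T' : H -> H) : is_adjoint T T' -> is_adjoint T' T.
Proof. by move=> TT' x y; rewrite innerC -TT' -innerC. Qed.

Lemma rinner_adjoint (T T' : H -> H) x y : is_adjoint T T' ->
  rinner (T x) y = rinner x (T' y).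
Proof. by move=> TT'; rewrite /rinner TT'. Qed.

Lemma inner_ext x y : (forall z, '[z, x] = '[z, y]) -> x = y.
Proof. by move=> xy; apply/subr0_eq/inner_eq0; rewrite innerBr xy subrr. Qed.

Lemma inner_extl x y : (forall z, '[x, z] = '[y, z]) -> x = y.
Proof. by move=> xy; apply: inner_ext => z; rewrite innerC xy -innerC. Qed.

(** Existence of the adjoint is the Riesz representation of
    [x |-> '[T x, y]]; linearity and boundedness follow from uniqueness of the
    representing vector and from [rnorm (T' y) ^+ 2 = rinner (T (T' y)) y]. *)
Lemma bounded_adjoint (T : {linear H -> H}) : bounded_operator T ->
  exists T' : {linear H -> H},
    [/\ bounded_operator T', adjoint T = T' & is_adjoint T T'].
Proof.
move=> /bounded_operatorP[M M0 TM].
have TS y : exists z, forall x, '[T x, y] = '[x, z].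
  have lf : linear_for *%R (fun x => '[T x, y]).
    by move=> a x z; rewrite linearP innerDl innerZl.
  pose f : {scalar H} :=
    HB.pack (fun x => '[T x, y]) (GRing.isLinear.Build _ _ _ _ _ lf).
  apply: (@Riesz_representation _ _ f (M * rnorm y)) => x.
  apply: le_trans (ler_norm _) _.
  apply: le_trans (CauchySchwarz_rinner _ _) _.
  by rewrite mulrAC ler_wpM2r ?rnorm_ge0.
have adj : is_adjoint T (adjoint T).
  by move=> x y; have [z zP] := TS y; rewrite (adjointE zP).
have ladj : linear (adjoint T).
  move=> a x y; apply: adjointE => z.
  by rewrite !innerDr !innerZr !adj.
pose T' : {linear H -> H} :=
  HB.pack (adjoint T) (GRing.isLinear.Build _ _ _ _ _ ladj).
exists T'; split=> //; apply/bounded_operatorP; exists M => // y.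
have [->|T'y0] := eqVneq (rnorm (T' y)) 0; first by rewrite mulr_ge0 ?rnorm_ge0.
have T'y : 0 < rnorm (T' y) by rewrite lt_neqAle eq_sym T'y0 rnorm_ge0.
rewrite -(ler_pM2l T'y) -expr2 -rinnerxx -(rinner_adjoint _ _ adj).
apply: le_trans (ler_norm _) _; apply: le_trans (CauchySchwarz_rinner _ _) _.
by rewrite mulrCA mulrA ler_wpM2r ?rnorm_ge0.
Qed.

End Adjoint.

(** * Moore-Penrose inverses *)

Section MoorePenrose.
Variables (R : realType) (H : hilbertType R).
Implicit Types (x y z : H) (S : set H).

(** The set of those [w] in the range of [T] with [rnorm (T' w) <= 1] is weakly
    bounded: against [T v] its elements give at most [rnorm v], and against
    the orthogonal complement of the range they give [0].  Closedness of the
    range splits every vector into two such parts. *)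
Lemma adjoint_bounded_below (T T' : {linear H -> H}) :
  is_adjoint T T' -> closed (range T) ->
  exists2 M, 0 <= M & forall w, range T w -> rnorm w <= M * rnorm (T' w).
Proof.
move=> TT' clT.
have [y|M MP] := @weakly_bounded_bounded _ _
    [set w | range T w /\ rnorm (T' w) <= 1].
  have [_ [v _ <-] yv] := closed_projection y (range_subspace T) clT.
  exists (rnorm v) => w [Tw T'w].
  have -> : rinner y w = rinner v (T' w).
    rewrite -(rinner_adjoint _ _ TT') -[y in LHS](subrK (T v)) rinnerDl.
    by rewrite rinnerC [X in X + _]/rinner yv// add0r.
  apply: le_trans (ler_norm _) _; apply: le_trans (CauchySchwarz_rinner _ _) _.
  by rewrite ler_piMr ?rnorm_ge0.
exists `|M| => // w [v _ Tv].
have [T'w0|T'w0] := eqVneq (rnorm (T' w)) 0.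
  suff -> : w = 0 by rewrite rnorm0 mulr_ge0 ?rnorm_ge0.
  by apply: inner_eq0; rewrite -{1}Tv TT' (rnorm_eq0 T'w0) linear0r.
have T'w : 0 < rnorm (T' w) by rewrite lt_neqAle eq_sym T'w0 rnorm_ge0.
have := MP ((rnorm (T' w))^-1%:C *: w); rewrite /= linearZ !rnormZ.
rewrite gtr0_norm ?invr_gt0// mulVf// => wM.
rewrite -ler_pdivrMr// mulrC; apply: le_trans (wM _) (ler_norm _).
split=> //; rewrite -Tv; exists ((rnorm (T' w))^-1%:C *: v) => //.
by rewrite linearZ Tv.
Qed.

(** A vector orthogonal to the range of [T'] is killed by [T]; hence the
    orthogonal complement of the null space has no part orthogonal to the range
    of [T'], and the projection onto its closure is the identity there. *)
Lemma nullspace_closure_range_adjoint (T T' : {linear H -> H}) x :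
  is_adjoint T T' -> orthocompl (nullspace T) x -> closure (range T') x.
Proof.
move=> TT' Nx.
have [p clp xp] := orthogonal_projection x (range_subspace T').
suff -> : x = p by [].
have Txp : nullspace T (x - p).
  apply: inner_eq0; rewrite TT'; apply: inner_eq0C; apply: xp.
  by exists (T (x - p)).
apply/subr0_eq/inner_eq0; rewrite innerBr Nx// sub0r.
by rewrite (inner_eq0C (closure_orthocompl clp xp)) oppr0.
Qed.

(** The open mapping theorem for an operator with closed range.  Approximate [x]
    by some [T' w] with [w] in the range of [T]: then
    [rinner x (T' w) = rinner (T x) w], and the bound of [w] by [T' w] gives
    [rnorm x ^+ 2 <= rnorm (T x) * M * rnorm x] in the limit. *)
Lemma closed_range_bounded_below (T : {linear H -> H}) :
  bounded_operator T -> closed (range T) ->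
  exists2 M, 0 <= M &
    forall x, orthocompl (nullspace T) x -> rnorm x <= M * rnorm (T x).
Proof.
move=> bT clT; have [T' [_ _ TT']] := bounded_adjoint bT.
have [M M0 MP] := adjoint_bounded_below TT' clT.
exists M => // x Nx; set t := M * rnorm (T x).
have t0 : 0 <= t by rewrite mulr_ge0 ?rnorm_ge0.
have [x0|x0] := eqVneq (rnorm x) 0; first by rewrite x0.
have {}x0 : 0 < rnorm x by rewrite lt_neqAle eq_sym x0 rnorm_ge0.
have approx e : 0 < e -> rnorm x ^+ 2 <= e * rnorm x + t * (rnorm x + e).
  move=> e0.
  have [_ [w' _ <-] xw'] :=
    (closureP _ _).1 (nullspace_closure_range_adjoint TT' Nx) _ e0.
  have [w Tw w'w] := closed_projection w' (range_subspace T) clT.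
  have T'w : T' w' = T' w.
    apply/subr0_eq/inner_eq0; rewrite -linearB (is_adjointC TT').
    by apply: inner_eq0C; apply: w'w; exists (T' (w' - w)).
  rewrite T'w in xw'.
  have -> : rnorm x ^+ 2 = rinner x (x - T' w) + rinner (T x) w.
    by rewrite (rinner_adjoint _ _ TT') -rinnerDr subrK rinnerxx.
  apply: lerD.
    apply: le_trans (ler_norm _) _; apply: le_trans (CauchySchwarz_rinner _ _) _.
    by rewrite mulrC ler_wpM2r ?rnorm_ge0// ltW.
  apply: le_trans (ler_norm _) _; apply: le_trans (CauchySchwarz_rinner _ _) _.
  rewrite /t mulrAC mulrC ler_wpM2r ?rnorm_ge0//.
  apply: le_trans (MP _ Tw) _; rewrite ler_wpM2l//.
  rewrite -(subrK x (T' w)) (le_trans (rnormD _ _))// rnormB.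
  by rewrite addrC lerD2l ltW.
rewrite -(ler_pM2r x0) -expr2; apply/ler_addgt0Pr => e e0.
have k0 : 0 < rnorm x + t by rewrite ltr_wpDr.
have := approx _ (divr_gt0 e0 k0).
have : e / (rnorm x + t) * (rnorm x + t) = e by rewrite divfK ?gt_eqF.
by lra.
Qed.

Lemma nullspace_closed (T : {linear H -> H}) :
  bounded_operator T -> closed (nullspace T).
Proof.
move=> bT; have [T' [_ _ TT']] := bounded_adjoint bT.
apply/closure_id/seteqP; split; first exact: subset_closure.
move=> x clx; apply: inner_eq0; rewrite TT'; apply: closure_orthocompl clx _.
by move=> s Ts; rewrite -TT' Ts inner0l.
Qed.

(** Every value of [T] is attained on the orthogonal complement of the null
    space: this is what makes the Moore-Penrose inverse total on the range. *)
Lemma initial_space_preimage (T : {linear H -> H}) v : bounded_operator T ->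
  exists2 x, orthocompl (nullspace T) x & T x = T v.
Proof.
move=> bT.
have [p Np vp] := closed_projection v (nullspace_subspace T) (nullspace_closed bT).
by exists (v - p); rewrite // linearB/= Np subr0.
Qed.

Lemma op_range_mp_inverse (T : {linear H -> H}) : bounded_operator T ->
  op_range (mp_inverse T) = orthocompl (nullspace T).
Proof.
move=> bT; apply/seteqP; split=> [_ [y [_ [z [[v _ <-] Rz ->]]] <-]|x Nx].
  have [x Nx <-] := initial_space_preimage v bT.
  by rewrite mp_inverseE.
exists (T x); last by rewrite -[T x]addr0 mp_inverseE// => s _; rewrite linear0r.
exists (T x), 0; split; first by exists x.
  by move=> s _; rewrite linear0r.
by rewrite addr0.
Qed.

(** The four Penrose equations.  Unlike the description by orthogonal
    complements, they pass to adjoints by mere transposition. *)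
Definition moore_penrose (T G : H -> H) :=
  [/\ forall x, T (G (T x)) = T x, forall x, G (T (G x)) = G x,
      is_adjoint (T \o G) (T \o G) & is_adjoint (G \o T) (G \o T)].

(** Under the Penrose equations [T \o G] and [G \o T] are the orthogonal
    projections onto the range of [T] and the orthogonal complement of its null
    space, so [G] solves the equation that defines the Moore-Penrose inverse. *)
Lemma moore_penrose_mp_inverse (T G : {linear H -> H}) : moore_penrose T G ->
  op_dom (mp_inverse T) = setT /\ op_fun (mp_inverse T) = G.
Proof.
case=> TGT GTG TG GT.
have NG y : orthocompl (nullspace T) (G y).
  move=> v Tv; rewrite -GTG -[G (T _)]/((G \o T) _) -GT/=.
  by rewrite [T v]Tv linear0 inner0l.
have RT y : orthocompl (range T) (y - T (G y)).
  move=> _ [v _ <-]; rewrite -TGT -[T (G _)]/((T \o G) _) TG/=.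
  by rewrite linearB/= linearB/= TGT subrr linear0r.
have E y : y = T (G y) + (y - T (G y)) by rewrite addrC subrK.
split; last by apply/funext => y; rewrite [in LHS](E y) mp_inverseE.
apply/seteqP; split=> // y _; exists (T (G y)), (y - T (G y)).
by split=> //; exists (G y).
Qed.

Lemma closed_range_moore_penrose (T : {linear H -> H}) :
  bounded_operator T -> closed (range T) ->
  exists2 G : {linear H -> H}, bounded_operator G & moore_penrose T G.
Proof.
move=> bT clT.
have /choice[G GP] y : exists x, orthocompl (nullspace T) x /\
    orthocompl (range T) (y - T x).
  have [_ [v _ <-] yv] := closed_projection y (range_subspace T) clT.
  by have [x Nx Tx] := initial_space_preimage v bT; exists x; rewrite Tx.
have G_unique x y : orthocompl (nullspace T) x ->
    orthocompl (range T) (y - T x) -> G y = x.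
  move=> Nx Rx; have [NG RG] := GP y.
  have Txy : T (G y - x) = 0.
    apply: inner_eq0; rewrite linearB -{1}linearB/=.
    have -> : T (G y) - T x = (y - T x) - (y - T (G y)).
      by rewrite opprB [RHS]addrC addrA subrK.
    by rewrite innerBr Rx ?RG ?subrr//; exists (G y - x).
  apply/subr0_eq/inner_eq0; rewrite innerBr.
  by rewrite NG// Nx// subrr.
have linG : linear G.
  move=> a x y; have [NGx RGx] := GP x; have [NGy RGy] := GP y.
  apply: G_unique => [v Nv|v Rv].
    by rewrite innerDr innerZr NGx// NGy// mulr0 addr0.
  rewrite linearP/= opprD addrACA -scalerBr.
  by rewrite innerDr innerZr RGx// RGy// mulr0 addr0.
have GT x : orthocompl (nullspace T) x -> G (T x) = x.
  by move=> Nx; apply: G_unique => // s _; rewrite subrr linear0r.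
have mp : moore_penrose T G.
  split=> [x|x|x y|x y] /=.
  - have [x' Nx' <-] := initial_space_preimage x bT.
    by rewrite GT.
  - by rewrite GT//; case: (GP x).
  - have [_ Rx] := GP x; have [_ Ry] := GP y.
    rewrite -[y in LHS](subrK (T (G y))) innerDr Ry ?add0r; last by exists (G x).
    rewrite -[x in RHS](subrK (T (G x))) innerDl.
    by rewrite (inner_eq0C (Rx _ _)) ?add0r//; exists (G y).
  - have TGT v : T (v - G (T v)) = 0.
      have [v' Nv' Tv'] := initial_space_preimage v bT.
      by rewrite linearB/= -Tv' GT// subrr.
    have GTo u v : '[G (T u), v - G (T v)] = 0.
      by apply: inner_eq0C; apply: (GP (T u)).1; exact: TGT.
    rewrite -[y in LHS](subrK (G (T y))) innerDr GTo add0r.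
    by rewrite -[x in RHS](subrK (G (T x))) innerDl (inner_eq0C (GTo _ _)) add0r.
pose G' : {linear H -> H} := HB.pack G (GRing.isLinear.Build _ _ _ _ _ linG).
exists G' => //; apply/bounded_operatorP.
have [M M0 MP] := closed_range_bounded_below bT clT.
exists M => // y; have [NG RG] := GP y.
apply: le_trans (MP _ NG) _; rewrite ler_wpM2l//.
have [->|TG0] := eqVneq (rnorm (T (G y))) 0; first exact: rnorm_ge0.
have {}TG0 : 0 < rnorm (T (G y)) by rewrite lt_neqAle eq_sym TG0 rnorm_ge0.
rewrite -(ler_pM2l TG0) -expr2 -rinnerxx.
have <- : rinner (T (G y)) y = rinner (T (G y)) (T (G y)).
  apply/eqP; rewrite -subr_eq0 -rinnerBr /rinner RG//; by exists (G y).
exact: le_trans (ler_norm _) (CauchySchwarz_rinner _ _).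
Qed.

Lemma moore_penrose_adjoint (T T' G G' : H -> H) :
  is_adjoint T T' -> is_adjoint G G' ->
  moore_penrose T G -> moore_penrose T' G'.
Proof.
move=> TT' GG' [TGT GTG TG GT]; split.
- by move=> x; apply: inner_ext => z; rewrite -TT' -GG' -TT' TGT TT'.
- by move=> x; apply: inner_ext => z; rewrite -GG' -TT' -GG' GTG GG'.
- move=> x y; rewrite /= (is_adjointC TT') (is_adjointC GG').
  by rewrite -TT' -GG'; exact/esym/GT.
- move=> x y; rewrite /= (is_adjointC GG') (is_adjointC TT').
  by rewrite -GG' -TT'; exact/esym/TG.
Qed.

End MoorePenrose.

(** * The minus and diamond orders *)

Section Orders.
Variables (R : realType) (H : hilbertType R).
Implicit Types (x y z : H) (S : set H).

Lemma op_range_mp_inverse_sub (A B GA GB : {linear H -> H}) :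
  moore_penrose A GA -> moore_penrose B GB ->
  op_range (op_sub (mp_inverse B) (mp_inverse A)) = range (GB \- GA).
Proof.
move=> /moore_penrose_mp_inverse[domA funA] /moore_penrose_mp_inverse[domB funB].
rewrite /op_range.
rewrite -[op_dom _]/(op_dom (mp_inverse B) `&` op_dom (mp_inverse A)) domA domB.
rewrite -[op_fun _]/(op_fun (mp_inverse B) \- op_fun (mp_inverse A)) funA funB.
by rewrite setTI.
Qed.

Section MoorePenroseAdjoint.
Variables (T T' G G' : H -> H).
Hypotheses (TT' : is_adjoint T T') (GG' : is_adjoint G G').
Hypothesis TG : moore_penrose T G.

Lemma moore_penrose_mulVl x : G (T x) = T' (G' x).
Proof.
have [_ _ _ GTsym] := TG.
by apply: inner_ext => z; rewrite -TT' -GG'; exact/esym/GTsym.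
Qed.

Lemma moore_penrose_mulVr x : T (G x) = G' (T' x).
Proof.
have [_ _ TGsym _] := TG.
by apply: inner_ext => z; rewrite -GG' -TT'; exact/esym/TGsym.
Qed.

Lemma range_fixed y : range T y -> T (G y) = y.
Proof. by have [TGT _ _ _] := TG; case=> x _ <-. Qed.

Lemma range_adjoint_fixed y : range T' y -> G (T y) = y.
Proof.
have [T'G'T' _ _ _] := moore_penrose_adjoint TT' GG' TG.
by case=> x _ <-; rewrite moore_penrose_mulVl.
Qed.

Lemma range_moore_penrose : range G `<=` range T'.
Proof.
have [_ GTG _ _] := TG.
by move=> _ [x _ <-]; exists (G' (G x)); rewrite // -moore_penrose_mulVl.
Qed.

End MoorePenroseAdjoint.

Section ClosedRangePair.
Variables (A B A' B' GA GB GA' GB' : {linear H -> H}).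
Hypotheses (AA' : is_adjoint A A') (BB' : is_adjoint B B').
Hypotheses (GAA' : is_adjoint GA GA') (GBB' : is_adjoint GB GB').
Hypotheses (mpA : moore_penrose A GA) (mpB : moore_penrose B GB).

(** Multiplying [A A' A = A B' A] by [GA] on both sides, and taking adjoints,
    turns it into an identity for the operator [GA], because [GA] factors through
    [A'] on either side ([GA = A' GA' GA = GA GA' A']); conversely [A'] factors
    through [GA], as [A' = GA A A' = A' A GA]. *)
Lemma diamond_identityP :
  A \o A' \o A = A \o B' \o A <-> forall x, GA (B (GA x)) = GA x.
Proof.
have [AGA GAG _ _] := mpA.
have [A'GA' _ _ _] := moore_penrose_adjoint AA' GAA' mpA.
have sandwich (U U' : H -> H) y z : is_adjoint U U' ->
    '[z, A' (U (A' y))] = '[A (U' (A z)), y].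
  by move=> UU'; rewrite -AA' -(is_adjointC UU') -AA'.
split=> [AAA x|outer].
  have A'AA' y : A' (B (A' y)) = A' (A (A' y)).
    apply: inner_ext => z; rewrite (sandwich _ _ _ _ BB') (sandwich _ _ _ _ AA').
    by rewrite -[A (B' _)]/((A \o B' \o A) z) -AAA.
  have [v _ <-] : range A' (GA x).
    by apply: (range_moore_penrose AA' GAA' mpA); exists x.
  have GAE y : GA y = GA (GA' (A' y)).
    by rewrite -(moore_penrose_mulVr AA' GAA' mpA) GAG.
  rewrite GAE A'AA' -GAE.
  by apply: (range_adjoint_fixed AA' GAA' mpA); exists v.
have A'E y : A' y = A' (A (GA y)).
  by rewrite (moore_penrose_mulVr AA' GAA' mpA) A'GA'.
have GA_A' y : GA (A (A' y)) = A' y.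
  by apply: (range_adjoint_fixed AA' GAA' mpA); exists y.
apply/funext => x; apply: inner_extl => y.
rewrite /= -(sandwich _ _ _ _ AA') -(sandwich _ _ _ _ BB').
by rewrite -(GA_A' y) (A'E (B _)) outer GA_A'.
Qed.

(** An element [z] of the range of [GA] which is orthogonal to the null space
    of [B - A] vanishes: [lift] moves [z], modulo the null space of [A], into
    the null space of [B - A].  It is applied to [z := y - GA (B y)] with
    [y := GA x], which lies in the range of [GB - GA] because [y] is in the
    range of the adjoint of [B]. *)
Lemma outer_inverse_of_lift :
  (forall v, exists2 u, A u = A v & B u = A v) ->
  range A' `<=` range B' ->
  range (GB \- GA) `<=` orthocompl (nullspace (B \- A)) ->
  forall x, GA (B (GA x)) = GA x.
Proof.
move=> lift A'B' rangeD x.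
have [_ GAG _ _] := mpA.
set y := GA x; pose z := y - GA (B y).
have yE : y = GB (B y).
  rewrite (range_adjoint_fixed BB' GBB' mpB)//; apply/A'B'.
  by apply: (range_moore_penrose AA' GAA' mpA); exists x.
have zNC : orthocompl (nullspace (B \- A)) z.
  by apply: rangeD; exists (B y); rewrite //= -yE.
have zE : z = GA (x - B y) by rewrite linearB.
suff z0 : z = 0 by apply/esym/subr0_eq.
apply: inner_eq0; have [u Au Bu] := lift z.
rewrite -{1}(subrK u z) innerDl (zNC u) ?addr0; last first.
  by rewrite /nullspace/= Au Bu subrr.
have zA : z = A' (GA' z) by rewrite -(moore_penrose_mulVl AA' GAA' mpA) zE GAG.
by rewrite [in X in '[_, X]]zA -AA' linearB/= Au subrr inner0l.
Qed.

(** The mirror image of [outer_inverse_of_lift]: now it is [B \o GA] that lifts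
    [z], modulo the null space of [GA], to the null space of [GB - GA]. *)
Lemma inner_inverse_of_outer :
  (forall x, GA (B (GA x)) = GA x) ->
  range A `<=` range B -> range A' `<=` range B' ->
  range (B \- A) `<=` range (GB' \- GA') ->
  forall x, A (GB (A x)) = A x.
Proof.
move=> outer AB A'B' rangeC x.
have [AGA _ Asym _] := mpA.
pose z := A x - A (GB (A x)).
have zC : range (B \- A) z.
  by exists (GB (A x)); rewrite //= (range_fixed mpB)//; apply: AB; exists x.
have zE : z = A (x - GB (A x)) by rewrite linearB.
suff z0 : z = 0 by apply/esym/subr0_eq.
have [w _ wz] := rangeC _ zC.
pose u := B (GA z).
have GBu : GB u = GA z.
  apply: (range_adjoint_fixed BB' GBB' mpB).
  apply: A'B'; apply: (range_moore_penrose AA' GAA' mpA); by exists z.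
apply: inner_eq0; rewrite -{1}(subrK u z) innerDl.
have -> : '[u, z] = 0.
  rewrite -wz /= innerBr -GBB' -GAA' GBu outer subrr //.
rewrite addr0 {2}zE -AGA -/(((A \o GA) (A _))) -Asym /=.
by rewrite linearB/= outer subrr linear0 inner0l.
Qed.

End ClosedRangePair.

Lemma adjoint_factor (T T' U U' Q Q' : H -> H) :
  is_adjoint T T' -> is_adjoint U U' -> is_adjoint Q Q' ->
  T' = Q \o U' -> T = U \o Q'.
Proof.
move=> TT' UU' QQ' T'E; apply/funext => x; apply: inner_extl => y.
by rewrite TT' T'E /= UU' -(is_adjointC QQ').
Qed.

Lemma range_sub_nullspace_adjoint (T T' : {linear H -> H}) :
  is_adjoint T T' -> range T `<=` orthocompl (nullspace T').
Proof.
by move=> TT' _ [x _ <-] y T'y; rewrite -(is_adjointC TT') T'y inner0l.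
Qed.

Lemma bounded_operator_comp (S T : {linear H -> H}) :
  bounded_operator S -> bounded_operator T -> bounded_operator (S \o T).
Proof.
move=> /bounded_operatorP[M M0 SM] /bounded_operatorP[N N0 TN].
apply/bounded_operatorP; exists (M * N); first exact: mulr_ge0.
move=> x; apply: le_trans (SM _) _.
by rewrite -mulrA ler_wpM2l.
Qed.

Lemma bounded_operatorB (S T : {linear H -> H}) :
  bounded_operator S -> bounded_operator T -> bounded_operator (S \- T).
Proof.
move=> /bounded_operatorP[M M0 SM] /bounded_operatorP[N N0 TN].
apply/bounded_operatorP; exists (M + N); first exact: addr_ge0.
move=> x; apply: le_trans (rnormD _ _) _.
by rewrite rnormN mulrDl lerD.
Qed.

End Orders.

Theorem theorem3p6 (R : realType) (H : hilbertType R) (A B : {linear H -> H})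
  (bA : bounded_operator A) (bB : bounded_operator B)
  (clA : closed (range A)) (clB : closed (range B))
  (hBA : op_range (mp_inverse (B \- A))
         = op_range (op_sub (mp_inverse B) (mp_inverse A)))
  (hBAs : op_range (mp_inverse (adjoint B \- adjoint A))
          = op_range (op_sub (mp_inverse (adjoint B))
                             (mp_inverse (adjoint A)))) :
  minus_le A B <-> diamond_le A B.
Proof.
have [A' [bA' AE AA']] := bounded_adjoint bA.
have [B' [bB' BE BB']] := bounded_adjoint bB.
have [GA bGA mpA] := closed_range_moore_penrose bA clA.
have [GB bGB mpB] := closed_range_moore_penrose bB clB.
have [GA' [bGA' _ GAA']] := bounded_adjoint bGA.
have [GB' [bGB' _ GBB']] := bounded_adjoint bGB.
have mpA' := moore_penrose_adjoint AA' GAA' mpA.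
have mpB' := moore_penrose_adjoint BB' GBB' mpB.
rewrite /minus_le /diamond_le AE BE in hBAs *.
rewrite op_range_mp_inverse ?(op_range_mp_inverse_sub mpA mpB) in hBA;
  last exact: bounded_operatorB.
rewrite op_range_mp_inverse ?(op_range_mp_inverse_sub mpA' mpB') in hBAs;
  last exact: bounded_operatorB.
split=> [[P [Q [[bP PP] [bQ QQ] APB A'QB']]]|[AB A'B' AAA]].
  have [P' [_ _ PP']] := bounded_adjoint bP.
  have [Q' [_ _ QQ']] := bounded_adjoint bQ.
  have ABQ := adjoint_factor AA' BB' QQ' A'QB'.
  have A'BP :=
    adjoint_factor (is_adjointC AA') (is_adjointC BB') PP' APB.
  have AB : range A `<=` range B.
    by move=> _ [x _ <-]; exists (Q' x); rewrite // ABQ.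
  have A'B' : range A' `<=` range B'.
    by move=> _ [x _ <-]; exists (P' x); rewrite // A'BP.
  split=> //; apply/(diamond_identityP AA' BB' GAA' mpA).
  apply: (outer_inverse_of_lift AA' BB' GAA' GBB' mpA mpB) => //; last first.
    by rewrite hBA.
  (* [B Q' = A] since [A' = Q B'], and then [A Q' = P B Q' = P A = A]. *)
  move=> v; exists (Q' v); last by rewrite ABQ.
  rewrite [in LHS]APB /= -[B (Q' v)]/((B \o Q') v) -ABQ APB /=.
  by rewrite -[P (P _)]/((P \o P) _) PP.
have outer := (diamond_identityP AA' BB' GAA' mpA).1 AAA.
have inner := inner_inverse_of_outer AA' BB' GAA' GBB' mpA mpB outer AB A'B'.
(* The range of [B - A] is orthogonal to the null space of its adjoint, and the
   second range condition identifies the complement of that null space. *)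
have {}inner : forall x, A (GB (A x)) = A x.
  apply: inner; rewrite -hBAs; apply: range_sub_nullspace_adjoint.
  by move=> x y /=; rewrite innerBl innerBr AA' BB'.
(* [A \o GB] is idempotent since [A GB A = A], and so is the adjoint of
   [GB \o A], which is [A' \o GB']. *)
exists (A \o GB), (A' \o GB'); split.
- split; first exact: bounded_operator_comp.
  by apply/funext => x /=; rewrite inner.
- split; first exact: bounded_operator_comp.
  apply/funext => x /=; apply: inner_ext => z.
  by rewrite -AA' -GBB' -AA' -GBB' inner GBB' AA'.
- have [_ _ _ GBsym] := mpB.
  apply/funext => x; apply: inner_extl => z; rewrite AA' [RHS]AA'.
  rewrite -[in LHS](range_adjoint_fixed BB' GBB' mpB (A'B' (A' z) _)); last by exists z.
  exact/esym/GBsym.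
- apply/funext => x; apply: inner_ext => z.
  by rewrite /= -!AA' -GBB' -BB' (range_fixed mpB)//; apply: AB; exists z.
Qed.
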